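(* For any $r\in\mathbb{N}$ there exists a constant $C(r)$ such that for every $0<\varepsilon<1$ and every $K_r$-excluded metric space $(X,d)$, the metric space $(X,d^{1-\varepsilon})$ (the $1-\varepsilon$ snowflake version of $(X,d)$) embeds into $\ell_2$ with distortion at most $C(r)/\sqrt{\varepsilon}$.
   Context: A metric space $(X,d)$ is called $K_r$-excluded if $X$ is a subset of the vertex set of a finite weighted graph which does not admit a $K_r$ minor ($K_r$ being the complete graph on $r$ vertices), and $d$ is the restriction to $X$ of the shortest-path metric of that weighted graph. A map $f$ from a metric space $(X,\rho)$ to $\ell_2$ has distortion at most $D$ if for some $s>0$, $s\,\rho(x,y)\le\|f(x)-f(y)\|_2\le D s\,\rho(x,y)$ for all $x,y\in X$. *)

(* Defs.v *)
From HB Require Import structures.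
From mathcomp Require Import all_boot all_order all_algebra.
From mathcomp Require Import all_classical all_reals all_analysis.

Set Implicit Arguments.
Unset Strict Implicit.
Unset Printing Implicit Defensive.
Import Order.TTheory GRing.Theory Num.Theory.
Import numFieldNormedType.Exports.
Local Open Scope ring_scope.

(* Finite simple graph with positive edge lengths; [gweight] is irrelevant on
   non-adjacent pairs. Connectedness is not required. *)
Record weighted_graph (R : realType) := WeightedGraph {
  vertex : finType;
  edge : rel vertex;
  edge_sym : symmetric edge;
  edge_irrefl : irreflexive edge;
  gweight : vertex -> vertex -> R;
  gweight_sym : forall x y, edge x y -> gweight x y = gweight y x;
  gweight_gt0 : forall x y, edge x y -> 0 < gweight x y
}.

Definition connected_in (V : finType) (e : rel V) (B : {set V}) : Prop :=
  (exists x, x \in B) /\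
  {in B &, forall x y,
    connect [rel u v | [&& u \in B, v \in B & e u v]] x y}.

(* The graph (U, eU) is a minor of (V, eV): [B u] is the branch set that is
   contracted onto the vertex u. *)
Definition is_minor (U V : finType) (eU : rel U) (eV : rel V) : Prop :=
  exists B : U -> {set V},
    [/\ forall u, connected_in eV (B u),
        forall u v, u != v -> [disjoint B u & B v]
      & forall u v, eU u v ->
          exists x y, [/\ x \in B u, y \in B v & eV x y]].

Definition complete_graph (r : nat) : rel 'I_r := [rel i j | i != j].

Section ShortestPath.
Context (R : realType) (G : weighted_graph R).

(* Length of the walk x :: p. *)
Definition walk_length (x : vertex G) (p : seq (vertex G)) : R :=
  \sum_(l <- pairmap (@gweight R G) x p) l.

(* Equal to +oo when x and y lie in different components. *)
Definition shortest_path_dist (x y : vertex G) : \bar R :=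
  ereal_inf [set (walk_length x p)%:E | p in
    [set p : seq (vertex G) | path (@edge R G) x p /\ last x p = y]]%classic.

End ShortestPath.

(* The equation forces i to be injective (it separates the points of X) and its
   image to lie in a single component (its left-hand side is finite). *)
Definition Kr_excluded (R : realType) (r : nat) (X : metricType R) : Prop :=
  exists G : weighted_graph R,
    ~ is_minor (@complete_graph r) (@edge R G) /\
    exists i : X -> vertex G,
      forall x y : X, (mdist x y)%:E = shortest_path_dist (i x) (i y).

(* Square-summable real sequences. *)
Definition ell2 (R : realType) :=
  LfunType (counting : {measure set nat -> \bar R}) (lee1n 2).

Definition ell2_norm (R : realType) (u : ell2 R) : R :=
  fine ('N[counting]_2%:E [EFin \o u])%E.

Definition embeds_ell2_with_distortion (R : realType) (X : Type)
    (rho : X -> X -> R) (D : R) : Prop :=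
  exists f : X -> ell2 R, exists2 s : R, 0 < s &
    forall x y : X,
      s * rho x y <= ell2_norm (f x - f y) <= D * s * rho x y.

Definition snowflake (R : realType) (X : metricType R) (eps : R) : X -> X -> R :=
  fun x y => mdist x y `^ (1 - eps).

(* Main.v *)
(** At a scale [D], chop the graph [r] times into annuli of width [D], each time
    around a root of every component. If some final cluster had diameter much
    larger than [r ^ 2 * D], then [r] far apart points of it could be developed,
    going back up through the chops, into a [K_r] minor (Klein, Plotkin and Rao).
    Choosing between two offsets of the annuli at every round gives [2 ^ r]
    partitions such that the ball of radius [D / 4] around any point lies in a
    single cluster of one of them. Mapping each point to its distance to the
    complement of its cluster, on a coordinate axis of its own for each cluster,
    yields a map that is Lipschitz, bounded by [D], and separates points at
    distance at least a constant times [D]. The snowflake embeds by the direct sum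
    of these maps over geometrically growing scales [tau], weighted by
    [tau ^ (- eps)]: the scales below [d(x, y)] contribute [d(x, y) ^ (2 - 2 eps)]
    up to a constant to the squared norm, those above at most [1 / eps] times it. *)

From HB Require Import structures.
Require Import Defs.
From mathcomp Require Import all_boot all_order all_algebra.
From mathcomp Require Import all_classical all_reals all_analysis.
From mathcomp Require Import ring lra zify.

Set Implicit Arguments.
Unset Strict Implicit.
Unset Printing Implicit Defensive.
Import Order.TTheory GRing.Theory Num.Theory.
Import numFieldNormedType.Exports.
Local Open Scope ring_scope.

(** * Shortest-path distances *)

Section GraphDistance.
Context (R : realType) (G : weighted_graph R).
Implicit Types (x y z : vertex G) (p : seq (vertex G)).

(** [fine] sends an infinite distance to 0, so vertices of different components are at [gdist] 0;
    hence the connectedness hypotheses below. *)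
Definition gdist x y : R := fine (shortest_path_dist x y).

Lemma walk_length_cons x y p :
  walk_length x (y :: p) = gweight x y + walk_length y p.
Proof. by rewrite /walk_length /= big_cons. Qed.

Lemma walk_length_nil x : walk_length x [::] = 0.
Proof. by rewrite /walk_length /= big_nil. Qed.

Lemma walk_length_cat x p q :
  walk_length x (p ++ q) = walk_length x p + walk_length (last x p) q.
Proof. by rewrite /walk_length pairmap_cat big_cat. Qed.

Lemma walk_length_rcons x p z :
  walk_length x (rcons p z) = walk_length x p + gweight (last x p) z.
Proof. by rewrite -cats1 walk_length_cat walk_length_cons walk_length_nil addr0. Qed.

Lemma walk_length_ge0 x p : path (@edge R G) x p -> 0 <= walk_length x p.
Proof.
elim: p x => [|y p IH] x /=; first by rewrite walk_length_nil.
by case/andP=> e_xy /IH; rewrite walk_length_cons; apply/addr_ge0/ltW/gweight_gt0.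
Qed.

Lemma sp_dist_ge0 x y : (0%:E <= shortest_path_dist x y)%E.
Proof.
by apply: le_ereal_inf_tmp => _ [p [xp _] <-]; rewrite lee_fin walk_length_ge0.
Qed.

Lemma sp_dist_le x p : path (@edge R G) x p ->
  (shortest_path_dist x (last x p) <= (walk_length x p)%:E)%E.
Proof. by move=> xp; apply: ereal_inf_lbound; exists p. Qed.

Lemma gdist_ge0 x y : 0 <= gdist x y.
Proof. exact/fine_ge0/sp_dist_ge0. Qed.

Lemma sp_dist_fin x y : connect (@edge R G) x y ->
  shortest_path_dist x y = (gdist x y)%:E.
Proof.
case/connectP=> p xp ->; rewrite /gdist fineK // fin_numE.
have := sp_dist_le xp; have := sp_dist_ge0 x (last x p).
by case: shortest_path_dist.
Qed.

Lemma sp_dist_disconnected x y : ~~ connect (@edge R G) x y ->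
  shortest_path_dist x y = +oo%E.
Proof.
move=> nxy; rewrite /shortest_path_dist.
rewrite (_ : [set _ | _ in _]%classic = set0) ?ereal_inf0 //.
rewrite -subset0 => t [p [xp lp] _]; case/connectP: nxy.
by exists p.
Qed.

Lemma gdist_le x p : path (@edge R G) x p -> gdist x (last x p) <= walk_length x p.
Proof.
move=> xp; rewrite -lee_fin -sp_dist_fin ?sp_dist_le //.
by apply/connectP; exists p.
Qed.

Lemma gdist_walk x y c : connect (@edge R G) x y -> gdist x y < c ->
  exists p, [/\ path (@edge R G) x p, last x p = y & walk_length x p < c].
Proof.
move=> cxy; rewrite -lte_fin -sp_dist_fin // => /ereal_inf_lt [t [p [xp lp] <-]] {t}.
by rewrite lte_fin => lt_p; exists p.
Qed.

Lemma connect_edge_sym : connect_sym (@edge R G).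
Proof. exact/sym_connect_sym/edge_sym. Qed.

Lemma gdist_disconnected x y : ~~ connect (@edge R G) x y -> gdist x y = 0.
Proof. by move=> /sp_dist_disconnected; rewrite /gdist => ->. Qed.

Lemma gdist_refl x : gdist x x = 0.
Proof.
apply/eqP; rewrite eq_le gdist_ge0 andbT.
by have := @gdist_le x [::] isT; rewrite walk_length_nil.
Qed.

Lemma gdist_edge_le x y z : edge y z -> gdist x z <= gdist x y + gweight y z.
Proof.
move=> e_yz; have [cxy|ncxy] := boolP (connect (@edge R G) x y); last first.
  rewrite !gdist_disconnected ?add0r ?(ltW (gweight_gt0 _)) //.
  apply: contra ncxy => /connect_trans; apply; apply: connect1.
  by rewrite edge_sym.
apply/ler_addgt0Pr => e e0.
have [|p [xp lp lt_p]] := @gdist_walk x y (gdist x y + e) cxy; first by rewrite ltrDl.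
have := @gdist_le x (rcons p z); rewrite last_rcons rcons_path lp xp e_yz.
by rewrite walk_length_rcons lp => /(_ isT); lra.
Qed.

Lemma gdist_lip x y z : edge y z -> `|gdist x y - gdist x z| <= gweight y z.
Proof.
move=> e_yz; have := gdist_edge_le x e_yz.
have e_zy : edge z y by rewrite edge_sym.
have := gdist_edge_le x e_zy; rewrite (gweight_sym e_zy) => *.
by rewrite ler_norml; lra.
Qed.

Lemma gdist_le_sym x y : gdist x y <= gdist y x.
Proof.
have [cyx|ncyx] := boolP (connect (@edge R G) y x); last first.
  by rewrite gdist_disconnected ?gdist_ge0 // connect_edge_sym.
apply/ler_addgt0Pr => e e0.
have [|p [yp lp lt_p]] := @gdist_walk y x (gdist y x + e) cyx; first by rewrite ltrDl.
apply/(le_trans _ (ltW lt_p)).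
elim: p y {cyx lt_p} yp lp => [y _ <-|z p IH y /= /andP[e_yz zp] lp].
  by rewrite gdist_refl walk_length_nil.
rewrite walk_length_cons; have := IH z zp lp.
have e_zy : edge z y by rewrite edge_sym.
by have := gdist_edge_le x e_zy; rewrite (gweight_sym e_zy); lra.
Qed.

Lemma gdist_sym x y : gdist x y = gdist y x.
Proof. by apply/eqP; rewrite eq_le !gdist_le_sym. Qed.

Lemma gdist_triangle x y z : connect (@edge R G) y z ->
  gdist x z <= gdist x y + gdist y z.
Proof.
move=> cyz; apply/ler_addgt0Pr => e e0.
have [|p [yp lp lt_p]] := @gdist_walk y z (gdist y z + e) cyz; first by rewrite ltrDl.
suff : gdist x z <= gdist x y + walk_length y p by lra.
elim: p y yp lp {cyz lt_p} => [y _ <-|w p IH y /= /andP[e_yw wp] lp].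
  by rewrite walk_length_nil addr0.
rewrite walk_length_cons; have := IH w wp lp.
by have := gdist_edge_le x e_yw; lra.
Qed.

(* The infimum over walks is attained because a vertex has finitely many
   neighbours, so that it is a minimum over the last edge. *)
Lemma gdist_pred x y : connect (@edge R G) x y -> y != x ->
  exists z, edge z y /\ gdist x y = gdist x z + gweight z y.
Proof.
move=> cxy ny; apply/not_existsP => nz.
(* [s] is the least excess over all possible last edges, positive if none is tight; a walk within
   [s] of the infimum then contradicts its own last edge. The default 1 covers a vertex without
   neighbours. *)
pose s := \big[Num.min/1]_(z : vertex G | edge z y)
            (gdist x z + gweight z y - gdist x y).
have s_gt0 : 0 < s.
  apply: lt_bigmin => [|z e_zy]; first exact: ltr01.
  rewrite subr_gt0 lt_neqAle gdist_edge_le // andbT.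
  by apply/eqP => eq; apply: (nz z).
have [|p [xp lp lt_p]] := @gdist_walk x y (gdist x y + s) cxy; first by rewrite ltrDl.
case/lastP: p xp lp lt_p => [/= _ eq|p z].
  by rewrite eq eqxx in ny.
rewrite rcons_path last_rcons walk_length_rcons => /andP[xp e_pz] eq; subst z.
have : s <= gdist x (last x p) + gweight (last x p) y - gdist x y.
  exact: bigmin_le_cond.
by have := gdist_le xp; lra.
Qed.

End GraphDistance.

(** * Extending a partial minor across an annulus *)

Section ConnectedSets.
Context (V : finType) (e : rel V).
Implicit Types (A B : {set V}) (u v : V).

Definition induced (B : {set V}) : rel V :=
  [rel u v | [&& u \in B, v \in B & e u v]].

Lemma connect_induced_sub A B u v : A \subset B ->
  connect (induced A) u v -> connect (induced B) u v.
Proof.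
move=> /fintype.subsetP AB; apply: connect_sub => {u v} u v /= /and3P[uA vA e_uv].
by apply: connect1; rewrite /induced /= !AB.
Qed.

Lemma connect_induced_sym B : symmetric e -> connect_sym (induced B).
Proof.
by move=> se; apply: sym_connect_sym => u v; rewrite /induced /= se andbCA.
Qed.

Lemma connect_induced_mem B u v : u \in B -> connect (induced B) u v -> v \in B.
Proof.
move=> uB /connectP[p]; elim: p u uB => [u uB _ -> //|w p IH u uB /=].
by case/andP=> /and3P[_ wB _] wp lp; apply: (IH w).
Qed.

Lemma connected_in_center B c : symmetric e -> c \in B ->
  (forall u, u \in B -> connect (induced B) c u) -> connected_in e B.
Proof.
move=> se cB cP; split; first by exists c.
move=> u v uB vB; apply: (connect_trans _ (cP v vB)).
by rewrite -/(induced B) connect_induced_sym ?cP.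
Qed.

End ConnectedSets.

Section Step.
Context (R : realType) (G : weighted_graph R) (D : R) (D_gt0 : 0 < D).
Notation V := (vertex G).
Implicit Types (S T B : {set V}) (u v x y z : V).

(** Only edges of length at most [D] are kept, so that a 1-Lipschitz function cannot jump over a
    band of width [D]. *)
Definition short : rel V := [rel u v | edge u v && (gweight u v <= D)].

Lemma short_sym : symmetric short.
Proof.
move=> u v; rewrite /short /= edge_sym; case e_vu: (edge v u) => //=.
by rewrite (gweight_sym e_vu).
Qed.

Definition lip_on S (g : V -> R) := forall u v, u \in S -> v \in S -> short u v ->
  `|g u - g v| <= gweight u v.

Lemma lip_on_gdist S x : lip_on S (gdist x).
Proof. by move=> u v _ _ /andP[e_uv _]; apply: gdist_lip. Qed.

(* The bound on [|g (a j) - g b|] expresses that [a j] is at distance at least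
   [D] from the branch set [A k] for the path metric of [T]. *)
Definition partial_minor (r : nat) T (M : R) (t : nat) :=
  exists (A : 'I_r -> {set V}) (a : 'I_r -> V),
  [/\ forall j, [/\ a j \in A j, A j \subset T & connected_in (@edge R G) (A j)],
      forall j k, j != k -> [disjoint A j & A k],
      forall j k, j != k -> forall b, b \in A k ->
        exists2 g, lip_on T g & D <= `|g (a j) - g b|,
      forall j k, j != k -> M <= gdist (a j) (a k)
    & forall i j : 'I_r, (i < t)%N -> i != j ->
        exists u v, [/\ u \in A i, v \in A j & edge u v]].

(** * Ancestor chains in a shortest-path tree *)

Section Tree.
Context (S : {set V}) (x : V) (h : V -> R) (p : V -> V).
Context (h_root : h x = 0) (h_ge0 : forall v, 0 <= h v) (p_root : p x = x).
Context (pP : forall v, v \in S -> v != x ->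
  [/\ p v \in S, short v (p v) & h (p v) = h v - gweight v (p v)]).


Context (xS : x \in S).

Lemma parent_mem v : v \in S -> p v \in S.
Proof. by move=> vS; have [->|/(pP vS)[]//] := eqVneq v x; rewrite p_root. Qed.

Lemma parent_le v : v \in S -> h (p v) <= h v.
Proof.
move=> vS; have [->|/(pP vS)[_ /andP[e_v _] ->]] := eqVneq v x.
  by rewrite p_root.
by rewrite gerBl ltW ?gweight_gt0.
Qed.

Lemma parent_lt v : v \in S -> v != x -> h (p v) < h v.
Proof.
by move=> vS /(pP vS)[_ /andP[e_v _] ->]; rewrite gtrBl gweight_gt0.
Qed.

Lemma ancestor_ind (P : V -> Prop) v : P v ->
  (forall y, fconnect p v y -> P y -> P (p y)) ->
  forall y, fconnect p v y -> P y.
Proof.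
move=> Pv PS y /iter_findex <-; elim: (findex _ _ _) => [//|n IH] /=.
by apply: PS IH; apply: fconnect_iter.
Qed.

Lemma ancestor_mem v y : v \in S -> fconnect p v y -> y \in S.
Proof.
by move=> vS; move: y; apply: ancestor_ind => // y _; apply: parent_mem.
Qed.

Lemma ancestor_parent v y : fconnect p v y -> fconnect p v (p y).
Proof. by move=> /connect_trans; apply; apply: fconnect1. Qed.

Lemma ancestor_le v y : v \in S -> fconnect p v y -> h y <= h v.
Proof.
move=> vS; move: y; apply: ancestor_ind => // y vy; apply: le_trans.
by rewrite parent_le // (ancestor_mem vS).
Qed.

(** Take the lowest ancestor of level at least [c]: unless it is the root, its parent falls below
    [c], and one short edge loses at most [D]. *)
Lemma ancestor_level v (c : R) : v \in S -> 0 <= c <= h v ->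
  exists y, [/\ fconnect p v y, c <= h y < c + D & h (p y) < c \/ y = x].
Proof.
have D0 := D_gt0; move=> vS /andP[c0 cv].
pose P y := fconnect p v y && (c <= h y).
have Pv : P v by rewrite /P connect0.
case: (arg_minP h Pv) => y /andP[vy cy] miny.
have yS := ancestor_mem vS vy.
have lt_py : y != x -> h (p y) < c.
  move=> yx; rewrite ltNge; apply/negP => cpy.
  have := parent_lt yS yx; rewrite ltNge miny //.
  by rewrite /P cpy ancestor_parent.
exists y; split=> //; last by have [|/lt_py] := eqVneq y x; [right|left].
rewrite cy /=; have [eq|yx] := eqVneq y x.
  by rewrite eq h_root; lra.
have [_ /andP[_ wy] hy] := pP yS yx.
by move: (lt_py yx); rewrite hy; lra.
Qed.

Lemma ancestor_root v : v \in S -> fconnect p v x.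
Proof.
move=> vS; have [|y [vy _]] := @ancestor_level v 0 vS; first by rewrite lexx h_ge0.
by case=> [|<- //]; rewrite ltNge h_ge0.
Qed.

(** Along the chain [h] drops by exactly the edge lengths, so [h v - h y] is the length of a path
    from [v] to [y], which the last hypothesis keeps inside [B]. *)
Lemma ancestor_lip B g v y : v \in S -> lip_on B g -> fconnect p v y ->
  (forall z, fconnect p v z -> h y <= h z -> z \in B) ->
  `|g v - g y| <= h v - h y.
Proof.
move=> vS gB; move: y; apply: ancestor_ind => [_|y vy IH B_y].
  by rewrite !subrr normr0.
have yS := ancestor_mem vS vy.
have py := parent_le yS.
have {}IH : `|g v - g y| <= h v - h y.
  by apply: IH => z vz yz; apply: B_y => //; apply: le_trans yz.
have [eq|yx] := eqVneq y x; first by rewrite eq p_root -eq.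
have [_ s_y hy] := pP yS yx.
have : `|g y - g (p y)| <= gweight y (p y).
  by apply: gB => //; apply: B_y => //; apply: ancestor_parent.
move: IH; rewrite !ler_norml => /andP[? ?] /andP[? ?].
by rewrite hy; lra.
Qed.

Lemma ancestor_connect B v y : v \in S -> fconnect p v y ->
  (forall z, fconnect p v z -> h y <= h z -> z \in B) ->
  connect (induced (@edge R G) B) v y.
Proof.
move=> vS; move: y; apply: ancestor_ind => [_|y vy IH B_y]; first exact: connect0.
have yS := ancestor_mem vS vy.
have py := parent_le yS.
apply: (@connect_trans _ _ y).
  by apply: IH => z vz yz; apply: B_y => //; apply: le_trans yz.
have [eq|yx] := eqVneq y x; first by rewrite eq p_root.
have [_ /andP[e_y _] hy] := pP yS yx.
by apply: connect1; rewrite /induced /= e_y !B_y // ancestor_parent.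
Qed.

Lemma ancestor_gdist v y u : v \in S -> fconnect p v y ->
  `|gdist u v - gdist u y| <= h v - h y.
Proof.
move=> vS vy; apply: (@ancestor_lip [set: V]%SET) => //; exact: lip_on_gdist.
Qed.

Lemma ancestor_gdist_le v y : v \in S -> fconnect p v y ->
  gdist v y <= h v - h y.
Proof.
by move=> vS /(@ancestor_gdist _ _ v vS); rewrite gdist_refl sub0r normrN ger0_norm ?gdist_ge0.
Qed.

Section Annulus.
Context (T : {set V}) (L : R) (TS : T \subset S) (h_lip : lip_on S h).
Context (T_level : forall v, v \in T -> L <= h v < L + D).
Context (T_comp : forall u v, u \in T -> v \in S -> short u v ->
  L <= h v < L + D -> v \in T).

(** Levels only decrease along the chain, so it stays in the band until it passes below [L], and [T]
    is closed under short edges inside the band. *)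
Lemma annulus_ancestor v y : v \in T -> fconnect p v y -> L <= h y -> y \in T.
Proof.
move=> vT; have vS := fintype.subsetP TS v vT.
move: y; apply: ancestor_ind => [//|y vy IH Lpy].
have yS := ancestor_mem vS vy.
have yT : y \in T by apply: IH; apply/(le_trans Lpy)/parent_le.
have [eq|yx] := eqVneq y x; first by rewrite eq p_root -eq.
have [pyS s_y _] := pP yS yx.
apply: (T_comp yT) => //; rewrite Lpy /=.
by case/andP: (T_level yT) => _; apply/le_lt_trans/parent_le.
Qed.

(* Klein, Plotkin and Rao: every branch set [A k] grows a tail, the part at level
   at least [L - 3 D] of the geodesic from [a k] to the root; the new branch set
   absorbs the tree formed by the remaining parts of the geodesics, and so touches
   all tails. The new marked points lie on the tails around level [L - 2 D], at
   distance at least [D] from the annulus and from the tree. *)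
Lemma partial_minor_step r (M : R) t : (1 < r)%N -> (t < r)%N -> 8 * D < M ->
  partial_minor r T M t -> partial_minor r S (M - 7 * D) t.+1.
Proof.
have D0 := D_gt0.
move=> r_gt1 lt_tr M_gt [A [a [Aa disjA farA wide adj]]].
pose tau := Ordinal lt_tr.
have aT k : a k \in T by have [aA /fintype.subsetP AT _] := Aa k; apply: AT.
have aS k : a k \in S by apply: (fintype.subsetP TS).
have A_level k y : y \in A k -> L <= h y.
  have [_ /fintype.subsetP AT _] := Aa k.
  by move=> /AT /T_level /andP[].
have a_level k : L <= h (a k) < L + D by apply: T_level.
have [c cE] : exists c : R, c = L - 3 * D by exists (L - 3 * D).
(* Otherwise all marked points would lie within [4 * D] of the root, and two of them at distance
   less than [8 * D]. *)
have c_gt0 : 0 < c.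
  rewrite ltNge; apply/negP => c_le0.
  pose j : 'I_r := Ordinal (ltnW r_gt1); pose k : 'I_r := Ordinal r_gt1.
  have jk : j != k by [].
  have := wide j k jk.
  have := ancestor_gdist_le (aS j) (ancestor_root (aS j)).
  have := ancestor_gdist (a j) (aS k) (ancestor_root (aS k)).
  have /andP[_ ?] := a_level j; have /andP[_ ?] := a_level k.
  rewrite h_root ler_norml => /andP[_ ?] ? ?.
  lra.
pose tail k := [set y | fconnect p (a k) y && (c <= h y)].
pose tree := [set y | (h y < c) && [exists k, fconnect p (a k) y]].
pose A' k := A k :|: tail k :|: (if k == tau then tree else finset.set0).
have tailP k y : y \in tail k -> [/\ fconnect p (a k) y, y \in S & c <= h y].
  by rewrite inE => /andP[ay cy]; split=> //; apply: ancestor_mem ay.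
(* A tail descends from a level below [L + D] to [c = L - 3 * D]. *)
have tail_gdist k y u : y \in tail k -> `|gdist u (a k) - gdist u y| <= 4 * D.
  case/tailP=> ay _ cy; apply: (le_trans (ancestor_gdist u (aS k) ay)).
  by have /andP[_ ] := a_level k; lra.
have AA' k : A k \subset A' k by rewrite /A' -finset.setUA finset.subsetUl.
have tailA' k : tail k \subset A' k.
  by apply/fintype.subsetP => y yk; rewrite /A' !finset.in_setU yk orbT.
have treeA' : tree \subset A' tau.
  by apply/fintype.subsetP => y yk; rewrite /A' !finset.in_setU eqxx yk orbT.
have A'P k y : y \in A' k -> [\/ y \in A k, y \in tail k | k = tau /\ y \in tree].
  rewrite /A' !finset.in_setU => /orP[/orP[]|]; [by constructor 1|by constructor 2|].
  by case: eqP => [->|_]; [constructor 3|rewrite finset.in_set0].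
have treeS y : y \in tree -> y \in S.
  by rewrite inE => /andP[_ /existsP[k]]; apply: ancestor_mem.
have tree_level y : y \in tree -> h y < c by rewrite inE => /andP[].
(* The geodesic from [a k] to a common vertex would stay in [T] and have length less than [D],
   against [farA]. *)
have A_tail j k y : j != k -> y \in A j -> y \in tail k -> False.
  move=> jk yj /tailP[ay yS _].
  have [|g gT] := @farA k j _ y yj; first by rewrite eq_sym.
  have Ly := A_level _ _ yj.
  have : `|g (a k) - g y| <= h (a k) - h y.
    apply: (ancestor_lip (aS k) gT ay) => z az yz.
    exact: annulus_ancestor az (le_trans Ly yz).
  by have /andP[_ ] := a_level k; lra.
have gdist_tail j k y : j != k -> y \in tail j -> M - 4 * D <= gdist (a k) y.
  move=> jk yj; have := tail_gdist j y (a k) yj; rewrite ler_norml => /andP[_].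
  by have := wide k j; rewrite eq_sym => /(_ jk); lra.
have tail_tail j k y : j != k -> y \in tail j -> y \in tail k -> False.
  move=> jk yj yk; have := gdist_tail j k y jk yj; have := tail_gdist k y (a k) yk.
  by rewrite gdist_refl ler_norml => /andP[? ?] ?; lra.
have tree_tail k y : y \in tree -> y \in tail k -> False.
  by move=> /tree_level ? /tailP[_ _]; lra.
have tree_A k y : y \in tree -> y \in A k -> False.
  by move=> /tree_level ? /A_level; lra.
have /choice[a' a'P] : forall k, exists y,
    fconnect p (a k) y /\ L - 2 * D <= h y < L - D.
  move=> k; have [|y [ay yL _]] := @ancestor_level (a k) (L - 2 * D) (aS k).
    by have := a_level k; lra.
  by exists y; split=> //; move: yL; lra.
have a'tail k : a' k \in tail k.
  by have [ay yL] := a'P k; rewrite inE ay /=; lra.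
(* Moving from [a j] to [a' j] costs at most [3 * D], on top of the [4 * D] lost along the tail. *)
have gdist_a' j k y : j != k -> y \in tail k -> M - 7 * D <= gdist (a' j) y.
  move=> jk yk; have := gdist_tail k j y _ yk; rewrite eq_sym => /(_ jk) gjy.
  have [ay yL] := a'P j; have := ancestor_gdist y (aS j) ay.
  have /andP[_ ?] := a_level j.
  by rewrite ![gdist y _]gdist_sym ler_norml => /andP[_]; lra.
have lip_gdist u : lip_on S (gdist u) by apply: lip_on_gdist.
exists A', a'; split.
- move=> k; split; first exact: (fintype.subsetP (tailA' k)).
  + apply/fintype.subsetP => y /A'P[].
    * by have [_ /fintype.subsetP AT _] := Aa k => /AT; apply: (fintype.subsetP TS).
    * by case/tailP.
    * by case=> _ /treeS.
  + have [aA _ [_ Acon]] := Aa k.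
    apply: (@connected_in_center _ _ _ (a k)) => [||y].
    * exact: edge_sym.
    * exact: (fintype.subsetP (AA' k)).
    * case/A'P=> [yA|yk|[eq_k yt]].
      - by apply: (connect_induced_sub (AA' k)); apply: Acon.
      - have [ay yS cy] := tailP _ _ yk.
        apply: (ancestor_connect (aS k) ay) => z az yz.
        apply: (fintype.subsetP (tailA' k)).
        by rewrite inE az (le_trans cy yz).
      (* When the branch set contains the tree, its centre and the given tree vertex are both joined
         to the root [x] along their ancestors. *)
      - have conx j z : fconnect p (a j) z -> z \in A' k -> tree \subset A' k ->
            (forall w, fconnect p z w -> c <= h w -> w \in A' k) ->
            connect (induced (@edge R G) (A' k)) z x.
          move=> az zk tk zw; have zS := ancestor_mem (aS j) az.
          apply: (ancestor_connect zS (ancestor_root zS)) => w aw _.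
          have [cw|wc] := leP c (h w); first exact: zw.
          apply: (fintype.subsetP tk); rewrite inE wc; apply/existsP; exists j.
          exact: connect_trans aw.
        have tk : tree \subset A' k by rewrite eq_k.
        apply: (@connect_trans _ _ x).
          apply: (conx k); rewrite ?connect0 ?(fintype.subsetP (AA' k)) //.
          move=> w aw cw; apply: (fintype.subsetP (tailA' k)).
          by rewrite inE aw.
        rewrite connect_induced_sym; last exact: edge_sym.
        move: (yt); rewrite inE => /andP[yc /existsP[j aj]].
        apply: (conx j) => //; first exact: (fintype.subsetP tk).
        move=> w aw cw; have := ancestor_le (ancestor_mem (aS j) aj) aw.
        lra.
- move=> j k jk; rewrite -finset.setI_eq0; apply/eqP/setP => y.
  rewrite finset.in_setI finset.in_set0.
  apply/negbTE/negP => /andP[/A'P yj /A'P yk].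
  have kj : k != j by rewrite eq_sym.
  case: yj yk => [yj|yj|[eqj yj]] [yk|yk|[eqk yk]].
  + have := disjoint_setI0 (disjA j k jk); move/finset.setP/(_ y).
    by rewrite finset.in_setI yj yk finset.in_set0.
  + exact: (A_tail j k y).
  + exact: (tree_A j y).
  + exact: (A_tail k j y).
  + exact: (tail_tail j k y).
  + exact: (tree_tail j y).
  + exact: (tree_A k y).
  + exact: (tree_tail k y).
  + by rewrite eqj eqk eqxx in jk.
(* [h] separates [a' j] from [A k], above, and from the tree, below; the distance from [a' j]
   separates it from the other tails. *)
- move=> j k jk y /A'P[yk|yk|[eqk yk]].
  + exists h => //; have [_ ?] := a'P j; have ? := A_level k y yk.
    by rewrite ler0_norm; lra.
  + exists (gdist (a' j)) => //; have := gdist_a' j k y jk yk.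
    rewrite gdist_refl sub0r normrN ger0_norm ?gdist_ge0 //.
    lra.
  + exists h => //; have [_ ?] := a'P j; have := tree_level _ yk.
    by move=> ?; rewrite ger0_norm; lra.
- by move=> j k jk; exact: gdist_a' (a'tail k).
- move=> i j; rewrite ltnS leq_eqVlt => /orP[/eqP eq_i|it] ij; last first.
    have [u [v [ui vj e_uv]]] := adj i j it ij.
    by exists u, v; split=> //; apply: (fintype.subsetP (AA' _)).
  have {eq_i} eq_i : i = tau by apply: val_inj.
  (* The geodesic of [a j] crosses level [c] along an edge from its tail to the tree; as [c] is
     positive, it does so before ending at the root. *)
  have [|y [ay yc py]] := @ancestor_level (a j) c (aS j).
    by have := a_level j; lra.
  have yS := ancestor_mem (aS j) ay.
  have yx : y != x.
    by apply/eqP => eq; move: yc; rewrite eq h_root; lra.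
  have [pyS /andP[e_y _] _] := pP yS yx.
  exists (p y), y; split; last by rewrite edge_sym.
  + rewrite eq_i; apply: (fintype.subsetP treeA'); rewrite inE.
    have {py}-> /= : h (p y) < c by case: py => // /eqP; rewrite (negbTE yx).
    by apply/existsP; exists j; apply: ancestor_parent.
  + apply: (fintype.subsetP (tailA' j)); rewrite inE ay.
    by case/andP: yc.
Qed.

End Annulus.

End Tree.
End Step.

(** * Iterated chopping into annuli *)

(** Every real is at distance at least 1/4 from the integers or from the half-integers; the shift
    moves the jumps of the floor away from [t]. *)
Lemma floor_half_shift (R : realType) (t : R) : exists b : bool,
  forall s, `|t - s| < 4^-1 ->
  Num.floor (s + b%:R / 2) = Num.floor (t + b%:R / 2).
Proof.
have fl (s : R) (k : int) : k%:~R <= s -> s < k%:~R + 1 -> Num.floor s = k.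
  by move=> ks sk; apply: floor_def; rewrite ks intrD1.
have k_le := floor_le_tmp t; have k_lt := floorD1_gt t; rewrite intrD1 in k_lt.
set k := Num.floor t in k_le k_lt.
have [lt1|ge1] := ltP (t - k%:~R) 4^-1; last first.
  have [lt3|ge3] := ltP (t - k%:~R) (3 / 4).
    exists false => s; rewrite ltr_norml => /andP[? ?].
    by rewrite mul0r !addr0 (@fl s k) ?(@fl t k) //; lra.
  exists true => s; rewrite ltr_norml => /andP[? ?].
  by rewrite (@fl _ (k + 1)) ?(@fl (t + _) (k + 1)) // ?intrD1 /=; lra.
exists true => s; rewrite ltr_norml => /andP[? ?].
by rewrite (@fl _ k) ?(@fl (t + _) k) //=; lra.
Qed.

Lemma connect_component (V : finType) (e e' : rel V) (v u : V) :
  subrel e' e -> connect e' v u ->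
  connect (induced e [set z | connect e' v z]) v u.
Proof.
move=> sub /connectP[q]; elim/last_ind: q u => [u _ -> //|q z IH u].
rewrite rcons_path last_rcons => /andP[vq e_qz] -> {u}.
have vlq : connect e' v (last v q) by apply/connectP; exists q.
apply: (connect_trans (IH _ vq erefl)); apply: connect1.
by rewrite /induced /= !inE vlq (connect_trans vlq (connect1 e_qz)) sub.
Qed.

Section Clusters.
Context (R : realType) (G : weighted_graph R) (D : R) (D_gt0 : 0 < D).
Notation V := (vertex G).
Notation short := (@short R G D).
Implicit Types (S T : {set V}) (u v w x y z : V) (o : seq bool).

Section Restriction.
Context (S : {set V}).

Lemma restrict_sym : symmetric (induced short S).
Proof. by move=> u v; rewrite /induced /= short_sym andbCA. Qed.

Lemma restrict_irrefl : irreflexive (induced short S).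
Proof. by move=> u; rewrite /induced /short /= edge_irrefl !andbF. Qed.

Lemma restrict_edge u v : induced short S u v -> edge u v.
Proof. by case/and3P=> _ _ /andP[]. Qed.

(** Packaged as a weighted graph on the same vertices, so that the results on [gdist] apply to
    distances measured inside [S]. *)
Definition restrict : weighted_graph R :=
  @WeightedGraph R V (induced short S) restrict_sym restrict_irrefl (@gweight R G)
    (fun u v s_uv => gweight_sym (restrict_edge s_uv))
    (fun u v s_uv => gweight_gt0 (restrict_edge s_uv)).

Definition level x v : R := @gdist R restrict x v.

Definition parent x v : V :=
  if [pick z | induced short S z v && (level x v == level x z + gweight z v)]
    is Some z then z else v.

Lemma level_lip x : lip_on D S (level x).
Proof.
move=> u v uS vS s_uv; apply: (@gdist_lip R restrict).
by rewrite /= /induced /= uS vS.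
Qed.

Lemma level_ge0 x v : 0 <= level x v.
Proof. exact: gdist_ge0. Qed.

Lemma level_root x : level x x = 0.
Proof. exact: gdist_refl. Qed.

Lemma parent_root x : parent x x = x.
Proof.
rewrite /parent; case: pickP => // z /andP[/restrict_edge /gweight_gt0 w_gt0].
rewrite level_root => /eqP eq; exfalso.
by have := level_ge0 x z; lra.
Qed.

Lemma parentP x v : connect (induced short S) x v -> v != x ->
  [/\ parent x v \in S, short v (parent x v)
    & level x (parent x v) = level x v - gweight v (parent x v)].
Proof.
move=> cxv vx; rewrite /parent; case: pickP => [z|nz].
  case/andP=> /and3P[zS vS s_zv] /eqP eq; split=> //; first by rewrite short_sym.
  by rewrite eq (gweight_sym (proj1 (andP s_zv))) addrK.
have [z [e_zv eq]] := @gdist_pred R restrict x v cxv vx.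
by have := nz z; rewrite (e_zv : induced short S z v) /level eq eqxx.
Qed.

End Restriction.

(** * Clusters obtained by repeated chopping *)

Definition root S v : V := odflt v [pick x in S].
Definition band S x (b : bool) v : int := Num.floor (level S x v / D + b%:R / 2).

(* [b] shifts the annuli by half their width. *)
Definition annulus S x b v : {set V} := [set z in S | band S x b z == band S x b v].

(** The head of the list is the last chop. A partition is encoded by the cell of each point;
    [cluster_eq] shows that the cells do form one. *)
Fixpoint cluster o v : {set V} :=
  if o is b :: o' then
    let S := cluster o' v in
    [set u | connect (induced short (annulus S (root S v) b v)) v u]
  else [set u | connect short v u].

Lemma cluster_refl o v : v \in cluster o v.
Proof. by case: o => [|b o]; rewrite inE connect0. Qed.

Lemma annulus_refl S x b v : v \in S -> v \in annulus S x b v.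
Proof. by rewrite inE eqxx => ->. Qed.

Lemma cluster_annulus b o v u : u \in cluster (b :: o) v ->
  u \in annulus (cluster o v) (root (cluster o v) v) b v.
Proof.
rewrite inE; apply/connect_induced_mem/annulus_refl/cluster_refl.
Qed.

Lemma cluster_sub b o v : cluster (b :: o) v \subset cluster o v.
Proof.
by apply/fintype.subsetP => u /cluster_annulus; rewrite inE => /andP[].
Qed.

Lemma root_indep S u v : v \in S -> root S u = root S v.
Proof. by move=> vS; rewrite /root; case: pickP => // /(_ v); rewrite vS. Qed.

Lemma root_mem o v : root (cluster o v) v \in cluster o v.
Proof.
by rewrite /root; case: pickP => //= _; apply: cluster_refl.
Qed.

(** By induction the previous clusters agree, hence so do their roots and the annuli; the new cells
    are components of the same set. *)
Lemma cluster_eq o u v : u \in cluster o v -> cluster o u = cluster o v.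
Proof.
elim: o u v => [|b o IH] u v uv.
  apply/finset.setP => w; rewrite !inE.
  apply: same_connect; first exact/sym_connect_sym/short_sym.
  by rewrite inE in uv; rewrite (sym_connect_sym (@short_sym _ G D)).
have ann := cluster_annulus uv.
have uo : u \in cluster o v by apply: (fintype.subsetP (cluster_sub b o v)).
have {}IH := IH _ _ uo.
rewrite /= IH (root_indep u (cluster_refl o v)).
set S := cluster o v in uo ann *; set x := root S v in ann *.
have -> : annulus S x b u = annulus S x b v.
  apply/finset.setP => w; rewrite !inE.
  by move: ann; rewrite inE => /andP[_ /eqP ->].
apply/finset.setP => w; rewrite !inE.
apply: same_connect; first exact/connect_induced_sym/short_sym.
by rewrite connect_induced_sym; [rewrite inE in uv|exact: short_sym].
Qed.

Lemma cluster_connected o v u : u \in cluster o v ->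
  connect (induced short (cluster o v)) v u.
Proof.
case: o => [|b o]; rewrite inE => vu; first exact: connect_component.
by apply: connect_component => // x y /and3P[].
Qed.

Lemma cluster_connected2 o v u w : u \in cluster o v -> w \in cluster o v ->
  connect (induced short (cluster o v)) u w.
Proof.
by move=> uv wv; rewrite -(cluster_eq uv) in wv *; apply: cluster_connected.
Qed.

(** The chops are undone from the last to the first. Each makes one more branch set adjacent to all
    others and costs [7 * D] of separation; more than [8 * D] must be left before every step. *)
Lemma cluster_minor r o v (M : R) t : (1 < r)%N -> (t + size o = r)%N ->
  8 * D + 7 * D * (size o)%:R < M -> partial_minor D r (cluster o v) M t ->
  is_minor (@complete_graph r) (@edge R G).
Proof.
move=> r_gt1; elim: o v M t => [|b o IH] v M t /=.
  rewrite addn0 => -> _ [A [a [Aa disjA _ _ adj]]].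
  by exists A; split=> // [j|i j]; [case: (Aa j)|apply: adj].
move=> tr M_gt min_T.
set S := cluster o v; set x := root S v.
have M_gt' : 8 * D + 7 * D * (size o)%:R < M - 7 * D.
  by move: M_gt; rewrite -natr1; lra.
apply: (IH v (M - 7 * D) t.+1) => //; first by rewrite addSnnS.
(* [L] is the lower end of the annulus of [v], found by inverting the floor. *)
pose L : R := ((band S x b v)%:~R - b%:R / 2) * D.
have bandP z : (band S x b z == band S x b v) = (L <= level S x z < L + D).
  rewrite {1}/band floor_eq intrD1 /L -[in RHS](divfK (lt0r_neq0 D_gt0) (level S x z)).
  rewrite -[X in _ = (_ && (_ < _ + X))]mul1r -mulrDl ler_pM2r // ltr_pM2r //.
  by apply/andP/andP => -[? ?]; split; lra.
have xS : x \in S by apply: root_mem.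
have min_ge0 : 0 <= 7 * D * (size o)%:R.
  by rewrite !mulr_ge0 // ltW.
apply: (@partial_minor_step R G D D_gt0 S x (level S x) (parent S x)
  _ _ _ _ _ (cluster (b :: o) v) L) => //.
- exact: level_root.
- exact: level_ge0.
- exact: parent_root.
- by move=> w wS; apply: parentP; apply: cluster_connected2.
- exact: cluster_sub.
- exact: level_lip.
- by move=> w /cluster_annulus; rewrite inE bandP => /andP[].
- move=> u w uT wS s_uw w_band; have uA := cluster_annulus uT.
  move: uT; rewrite !inE => /connect_trans; apply; apply: connect1.
  by rewrite /induced /= uA inE wS bandP w_band.
- by rewrite -tr -addSnnS leq_addr.
- by have D0 := D_gt0; lra.
Qed.

(** A discrete intermediate value theorem: an edge changes [g] by at most [D], so the walk cannot
    skip the window. *)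
Lemma lip_crossing T (g : V -> R) u w (c : R) : lip_on D T g ->
  u \in T -> connect (induced short T) u w -> g u < c + D -> c <= g w ->
  exists2 z, z \in T & c <= g z < c + D.
Proof.
move=> gT uT /connectP[q]; elim: q u uT => [u uT _ ->|y q IH u uT /=].
  by move=> gu cu; exists u => //; rewrite cu.
case/andP=> /and3P[_ yT s_uy] yq lq gu cw.
have [cu|uc] := leP c (g u); first by exists u => //; rewrite cu.
apply: (IH y) => //; have /andP[_ w_le] := s_uy.
by have := gT u y uT yT s_uy; rewrite ler_norml => /andP[]; lra.
Qed.

Lemma cluster_diam r o v u w :
  ~ is_minor (@complete_graph r) (@edge R G) -> size o = r ->
  u \in cluster o v -> w \in cluster o v ->
  gdist u w < (7 * r%:R + 10) * D * r%:R.
Proof.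
have D0 := D_gt0.
move=> no_minor o_r uv wv; rewrite ltNge; apply/negP => far; apply: no_minor.
(* For [r <= 1] singletons suffice, as there are no two distinct branch sets. *)
have [r_gt1|r_le1] := ltnP 1 r; last first.
  exists (fun=> [set u]); split.
  - move=> i; apply: (@connected_in_center _ _ _ u); rewrite ?finset.in_set1 //.
      exact: edge_sym.
    by move=> z; rewrite finset.in_set1 => /eqP ->; apply: connect0.
  - move=> i j /eqP[]; apply: val_inj => /=.
    by have := ltn_ord i; have := ltn_ord j; lia.
  - move=> i j /eqP[]; apply: val_inj => /=.
    by have := ltn_ord i; have := ltn_ord j; lia.
pose T := cluster o v.
(* Points at distances about [j * N] from [u] are pairwise at least [N - D = (7 * r + 9) * D] apart,
   more than the [8 * D + 7 * D * r] needed to go back through [r] chops. *)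
pose N : R := (7 * r%:R + 10) * D.
have N_ge : 10 * D <= N.
  have : 0 <= 7 * r%:R * D by rewrite !mulr_ge0 // ltW.
  by rewrite /N; lra.
have /choice[a aP] : forall j : 'I_r, exists z,
    z \in T /\ j%:R * N <= gdist u z < j%:R * N + D.
  move=> j; have [||||z zT zP] := @lip_crossing T (gdist u) u w (j%:R * N) _ uv.
  - exact: lip_on_gdist.
  - exact: cluster_connected2.
  - by rewrite gdist_refl ltr_wpDl // mulr_ge0 //; lra.
  - apply: le_trans far; rewrite mulrC ler_wpM2l //; first by lra.
    by rewrite ler_nat ltnW.
  - by exists z.
have short_edge x y : connect (induced short T) x y -> connect (@edge R G) x y.
  by apply: connect_sub => x' y' /restrict_edge; apply: connect1.
have wide_lt (j k : 'I_r) : (j < k)%N -> N - D <= gdist (a j) (a k).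
  move=> jk; have [ajT ajP] := aP j; have [akT akP] := aP k.
  have := @gdist_triangle R G u (a j) (a k).
  rewrite short_edge ?cluster_connected2 // => /(_ isT).
  have : (j.+1)%:R * N <= k%:R * N by rewrite ler_wpM2r ?ler_nat //; lra.
  by rewrite -natr1 mulrDl mul1r; lra.
have wide (j k : 'I_r) : j != k -> N - D <= gdist (a j) (a k).
  rewrite -val_eqE neq_ltn => /orP[/wide_lt //|/wide_lt].
  by rewrite gdist_sym.
apply: (@cluster_minor r o v (N - D) 0 r_gt1); rewrite ?add0n //.
  by rewrite o_r /N; lra.
exists (fun j => [set a j]), a; split=> //.
- move=> j; have [aT _] := aP j; split; rewrite ?finset.in_set1 //.
    by rewrite finset.sub1set.
  apply: (@connected_in_center _ _ _ (a j)); rewrite ?finset.in_set1 //.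
    exact: edge_sym.
  by move=> z; rewrite finset.in_set1 => /eqP ->; apply: connect0.
- move=> j k jk; rewrite disjoints1 finset.in_set1; apply/eqP => eq.
  by have := wide j k jk; rewrite eq gdist_refl; lra.
- move=> j k jk y; rewrite finset.in_set1 => /eqP ->.
  exists (gdist (a j)); first exact: lip_on_gdist.
  by rewrite gdist_refl sub0r normrN ger0_norm ?gdist_ge0 //; have := wide j k jk; lra.
Qed.

(** The offsets are chosen one chop at a time: along walks shorter than [D / 4] the level stays
    within [D / 4] of its value at [v], so one offset keeps all of them in a single annulus. *)
Lemma padded_walk n v : exists2 o : seq bool, size o = n &
  forall q, path (@edge R G) v q -> walk_length v q < D / 4 ->
  last v q \in cluster o v.
Proof.
have D0 := D_gt0.
have walk_short q z : path (@edge R G) v (rcons q z) ->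
    walk_length v (rcons q z) < D / 4 ->
    [/\ path (@edge R G) v q, walk_length v q < D / 4 & short (last v q) z].
  rewrite rcons_path walk_length_rcons => /andP[vq e_qz] lt_q.
  have := walk_length_ge0 vq; have := gweight_gt0 e_qz.
  by split=> //; [lra|rewrite /short /= e_qz /=; lra].
elim: n => [|n [ o o_n IH]].
  exists [::] => //; elim/last_ind => [|q z IH vq lt_q]; first by rewrite inE connect0.
  rewrite last_rcons; have [vq' lt_q' s_qz] := walk_short _ _ vq lt_q.
  have := IH vq' lt_q'; rewrite !inE => /connect_trans; apply.
  exact: connect1.
set S := cluster o v in IH; set x := root S v.
have level_walk q : path (@edge R G) v q -> walk_length v q < D / 4 ->
    `|level S x v - level S x (last v q)| <= walk_length v q.
  elim/last_ind: q => [|q z IHq vq lt_q].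
    by rewrite /= subrr normr0 walk_length_nil.
  have [vq' lt_q' s_qz] := walk_short _ _ vq lt_q.
  have := level_lip x (IH _ vq' lt_q') (IH _ vq lt_q).
  rewrite last_rcons => /(_ s_qz); have := IHq vq' lt_q'.
  rewrite walk_length_rcons !ler_norml => /andP[? ?] /andP[? ?].
  lra.
have [b bP] := floor_half_shift (level S x v / D).
exists (b :: o); first by rewrite /= o_n.
move=> q vq lt_q.
have ann q' : path (@edge R G) v q' -> walk_length v q' < D / 4 ->
    last v q' \in annulus S x b v.
  move=> vq' lt_q'; rewrite inE IH //= /band bP //.
  rewrite -mulrBl normrM (@gtr0_norm _ D^-1) ?invr_gt0 // ltr_pdivrMr //.
  by apply: le_lt_trans (level_walk _ vq' lt_q') _; rewrite mulrC.
rewrite inE -/S -/x.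
elim/last_ind: q vq lt_q => [|q z IHq] vq lt_q; first exact: connect0.
have [vq' lt_q' s_qz] := walk_short _ _ vq lt_q.
apply: (connect_trans (IHq vq' lt_q')); apply: connect1.
have := ann _ vq lt_q; rewrite last_rcons => zA.
by rewrite /induced /= ann // zA.
Qed.

End Clusters.

(** * Finite vectors in l2 *)

Section FiniteVectors.
Context (R : realType).

Lemma Lnorm_finite_support (u : nat -> R) N : (forall k, (N <= k)%N -> u k = 0) ->
  Lnorm (counting : {measure set nat -> \bar R}) 2%:E (EFin \o u) =
  (Num.sqrt (\sum_(k < N) u k ^+ 2))%:E.
Proof.
move=> u0; rewrite Lnorm_counting //.
have sqr k : ((`|(EFin \o u) k| `^ 2)%E = (u k ^+ 2)%:E).
  by rewrite /= powR_mulrn // real_normK // num_real.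
under eq_eseriesr do rewrite sqr.
rewrite (@nneseries_split _ _ 0 N) => [|k _]; last by rewrite lee_fin sqr_ge0.
rewrite add0n eseries0 ?adde0 => [|k Nk _]; last by rewrite u0 // expr0n.
rewrite sumEFin big_mkord poweR_EFin powR12_sqrt //.
by apply: sumr_ge0 => k _; apply: sqr_ge0.
Qed.

Section Vector.
Context (I : finType) (c : I -> R).

Definition vector_seq (k : nat) : R := nth 0 [seq c i | i <- enum I] k.

Lemma vector_seq0 k : (#|I| <= k)%N -> vector_seq k = 0.
Proof. by move=> Ik; rewrite /vector_seq nth_default // size_map -cardE. Qed.

Lemma vector_seq_finite :
  finite_norm (counting : {measure set nat -> \bar R}) 2%:E vector_seq.
Proof. by rewrite /finite_norm (Lnorm_finite_support vector_seq0) ltry. Qed.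

HB.instance Definition _ := isMeasurableFun.Build _ _ nat R vector_seq
  (fun _ _ _ => Logic.I).
HB.instance Definition _ := @isLfunction.Build _ nat R counting _ (lee1n 2)
  vector_seq vector_seq_finite.

Definition ell2_vector : ell2 R := vector_seq.

End Vector.

Lemma ell2_normB (I : finType) (c d : I -> R) :
  ell2_norm (ell2_vector c - ell2_vector d) =
  Num.sqrt (\sum_(i : I) (c i - d i) ^+ 2).
Proof.
have valE k : (ell2_vector c - ell2_vector d) k = vector_seq c k - vector_seq d k by [].
rewrite /ell2_norm (@Lnorm_finite_support _ #|I|) => [|k Ik]; last first.
  by rewrite valE !vector_seq0 // subrr.
congr Num.sqrt; rewrite [RHS](reindex _ (onW_bij _ (@enum_val_bij I))).
apply: eq_bigr => k _; rewrite valE.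
have Ek e : vector_seq e k = e (enum_val k).
  by rewrite /vector_seq (nth_map (enum_val k)) -?cardE // -enum_val_nth.
by rewrite !Ek.
Qed.

End FiniteVectors.

(** * Embedding at a single scale *)

(** This is the contribution of one partition, where each point has its only possibly nonzero
    coordinate at its own cluster. *)
Lemma sum_two_point (R : realType) (I : finType) (p q : I) (a b : R) :
  \sum_(i : I) ((if i == p then a else 0) - (if i == q then b else 0)) ^+ 2 =
  if p == q then (a - b) ^+ 2 else a ^+ 2 + b ^+ 2.
Proof.
rewrite (bigD1 p) //= eqxx; have [<-|pq] := eqVneq p q.
  rewrite big1 ?addr0 // => i /negbTE ->.
  by rewrite subr0 expr0n.
have qp : (q == p) = false by rewrite eq_sym (negbTE pq).
rewrite (bigD1 q) ?qp //= eqxx.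
rewrite big1 => [|i /andP[/negbTE -> /negbTE ->]]; last by rewrite subr0 expr0n.
by rewrite !subr0 sub0r sqrrN addr0.
Qed.

Section SingleScale.
Context (R : realType) (X : metricType R) (G : weighted_graph R).
Context (i : X -> vertex G).
Context (i_dist : forall x y : X, (mdist x y)%:E = shortest_path_dist (i x) (i y)).

Lemma gdist_mdist x y : gdist (i x) (i y) = mdist x y.
Proof. by rewrite /gdist -i_dist. Qed.

Lemma connect_image x y : connect (@edge R G) (i x) (i y).
Proof.
apply: contraT => /sp_dist_disconnected eq.
by have := i_dist x y; rewrite eq.
Qed.

(** * Truncated distance to the complement of a cluster *)

Section Padding.
Context (D : R) (D_gt0 : 0 < D).

(** The value [D / 4] truncates the distance and keeps the set nonempty when the cluster contains
    all of [X]. *)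
Definition pad_values o x : set R :=
  [set t | t = D / 4 \/
    exists2 y, i y \notin cluster D o (i x) & t = mdist x y]%classic.

Definition pad o x : R := inf (pad_values o x).

Lemma pad_values_ge0 o x : lbound (pad_values o x) 0.
Proof.
by move=> t [->|[y _ ->]]; [rewrite divr_ge0 ?ltW|apply: mdist_ge0].
Qed.

Lemma pad_lb o x c : (forall t, pad_values o x t -> c <= t) -> c <= pad o x.
Proof. by move=> lb; apply: lb_le_inf => //; exists (D / 4); left. Qed.

Lemma pad_le o x t : pad_values o x t -> pad o x <= t.
Proof. by move=> xt; apply: ge_inf => //; exists 0; apply: pad_values_ge0. Qed.

Lemma pad_ge0 o x : 0 <= pad o x.
Proof. by apply: pad_lb => t; apply: pad_values_ge0. Qed.

Lemma pad_le_width o x : pad o x <= D / 4.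
Proof. by apply: pad_le; left. Qed.

Lemma pad_le_dist o x y : i y \notin cluster D o (i x) -> pad o x <= mdist x y.
Proof. by move=> yx; apply: pad_le; right; exists y. Qed.

Lemma pad_lip o x y : cluster D o (i x) = cluster D o (i y) ->
  pad o x - pad o y <= mdist x y.
Proof.
move=> eq; rewrite lerBlDl -lerBlDr; apply: pad_lb => t [->|[z zy ->]].
  by rewrite lerBlDr (le_trans (pad_le_width o x)) // lerDl mdist_ge0.
rewrite lerBlDl; apply: le_trans (metric_triangle x y z).
by apply: pad_le_dist; rewrite eq.
Qed.

Lemma pad_full n x : exists o : n.-tuple bool, pad o x = D / 4.
Proof.
have [ o o_n oP] := padded_walk D_gt0 n (i x).
have near y : mdist x y < D / 4 -> i y \in cluster D o (i x).
  rewrite -gdist_mdist => /(gdist_walk (connect_image x y))[p [xp <- lt_p]].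
  exact: oP.
have o_n' : size o == n by rewrite o_n.
exists (Tuple o_n'); apply/eqP; rewrite eq_le pad_le_width /=.
apply: pad_lb => t [->//|[y yx ->]].
by rewrite leNgt; apply: contra yx; apply: near.
Qed.

(* Distinct clusters get orthogonal coordinates, which replaces the independent
   random signs of the usual single-scale embedding. *)
Definition cluster_map (n : nat) x (j : n.-tuple bool * {set vertex G}) : R :=
  if j.2 == cluster D j.1 (i x) then pad j.1 x else 0.

Lemma cluster_map_sum n x y :
  \sum_j (@cluster_map n x j - cluster_map y j) ^+ 2 =
  \sum_(o : n.-tuple bool) (if cluster D o (i x) == cluster D o (i y)
     then (pad o x - pad o y) ^+ 2 else pad o x ^+ 2 + pad o y ^+ 2).
Proof.
rewrite -(pair_bigA _ (fun o Q => (@cluster_map n x (o, Q) - cluster_map y (o, Q)) ^+ 2)).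
by apply: eq_bigr => o _; rewrite -sum_two_point; apply: eq_bigr.
Qed.

(** In a common cluster [pad] is Lipschitz; in different clusters each [pad] is at most the distance
    to the other point. The parameter [m] covers both the Lipschitz bound and the uniform one. *)
Lemma cluster_map_le n x y (m : R) : mdist x y <= m \/ D / 4 <= m ->
  \sum_j (@cluster_map n x j - cluster_map y j) ^+ 2 <= (2 ^ n)%:R * (2 * m ^+ 2).
Proof.
move=> dm; rewrite cluster_map_sum.
apply: (@le_trans _ _ (\sum_(o : n.-tuple bool) 2 * m ^+ 2)); last first.
  by rewrite sumr_const card_tuple card_bool [leRHS]mulr_natl.
apply: ler_sum => o _.
have := pad_ge0 o x; have := pad_ge0 o y.
have := pad_le_width o x; have := pad_le_width o y.
case: eqP => [eq|neq] *.
  have : `|pad o x - pad o y| <= m.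
    rewrite ler_norml; case: dm => [dm|]; last by lra.
    have := pad_lip eq; have := pad_lip (esym eq).
    by rewrite metric_sym; lra.
  by rewrite ler_norml => /andP[? ?]; nra.
have xm : pad o x <= m.
  case: dm => [dm|]; last by lra.
  apply/(le_trans _ dm)/pad_le_dist/negP => yx.
  by apply: neq; rewrite (cluster_eq yx).
have ym : pad o y <= m.
  case: dm => [dm|]; last by lra.
  apply/(le_trans _ dm); rewrite metric_sym.
  by apply/pad_le_dist/negP => xy; apply: neq; rewrite (cluster_eq xy).
by nra.
Qed.

(** No cluster can hold both points, so the partition padded at [x] alone contributes
    [(D / 4) ^+ 2]. *)
Lemma cluster_map_ge n x y : (forall o (v u w : vertex G), size o = n ->
    u \in cluster D o v -> w \in cluster D o v -> gdist u w < mdist x y) ->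
  (D / 4) ^+ 2 <= \sum_j (@cluster_map n x j - cluster_map y j) ^+ 2.
Proof.
move=> far; have [ o ox] := pad_full n x.
rewrite cluster_map_sum (bigD1 o) //= ox.
have -> : (cluster D o (i x) == cluster D o (i y)) = false.
  apply/eqP => eq; have := far o (i y) (i x) (i y) (size_tuple o).
  by rewrite -{1}eq !cluster_refl gdist_mdist ltxx => /(_ isT isT).
rewrite -addrA lerDl addr_ge0 ?sqr_ge0 //; apply: sumr_ge0 => o' _.
by case: ifP => _; rewrite ?addr_ge0 ?sqr_ge0.
Qed.

End Padding.

Lemma single_scale r (tau : R) : ~ is_minor (@complete_graph r) (@edge R G) ->
  0 < tau ->
  let K : R := (2 ^ r.+1)%:R + 16 * ((7 * r%:R + 10) * r%:R + 1) ^+ 2 in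
  exists phi : X -> r.-tuple bool * {set vertex G} -> R, forall x y,
  [/\ \sum_j (phi x j - phi y j) ^+ 2 <= K * mdist x y ^+ 2,
      \sum_j (phi x j - phi y j) ^+ 2 <= K * tau ^+ 2
    & tau <= mdist x y -> tau ^+ 2 <= K * \sum_j (phi x j - phi y j) ^+ 2].
Proof.
move=> no_minor tau_gt0; set c : R := (7 * r%:R + 10) * r%:R + 1 => K.
have c_ge1 : 1 <= c by rewrite /c lerDr mulr_ge0 // addr_ge0 // mulr_ge0.
have c_gt0 : 0 < c by lra.
(* With this width the clusters have diameter less than [tau], and [tau] is [4 * c] times the
   padding [D / 4], whence the term [16 * c ^+ 2] in [K]. *)
pose D : R := tau / c.
have D_gt0 : 0 < D by rewrite divr_gt0.
have tauE : tau = D * c by rewrite /D divfK // gt_eqF.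
have pow_ge0 : 0 <= (2 ^ r.+1)%:R :> R by [].
have pow_le : (2 ^ r.+1)%:R <= K by rewrite /K lerDl mulr_ge0 ?sqr_ge0.
have c_le : 16 * c ^+ 2 <= K by rewrite /K lerDr.
have upper x y m : mdist x y <= m \/ D / 4 <= m ->
    \sum_j (@cluster_map D r x j - cluster_map D y j) ^+ 2 <= K * m ^+ 2.
  move=> /(cluster_map_le D_gt0 r) /le_trans; apply.
  by rewrite mulrCA mulrA -natrM -expnS ler_wpM2r ?sqr_ge0.
exists (@cluster_map D r) => x y; split.
- by apply: upper; left.
- by apply: upper; right; rewrite tauE; nra.
- move=> tau_le.
  have low : (D / 4) ^+ 2 <= \sum_j (@cluster_map D r x j - cluster_map D y j) ^+ 2.
    apply: cluster_map_ge => // o v u w o_r uv wv.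
    apply: lt_le_trans (cluster_diam D_gt0 no_minor o_r uv wv) _.
    apply: le_trans tau_le; rewrite tauE /c.
    by rewrite mulrDr mulr1 mulrAC mulrC; lra.
  apply: (@le_trans _ _ (16 * c ^+ 2 * (D / 4) ^+ 2)).
    by rewrite tauE; lra.
  apply: ler_pM => //; rewrite ?sqr_ge0 //.
  by rewrite mulr_ge0 ?sqr_ge0.
Qed.

End SingleScale.

(** * Combining the scales *)

Section GeometricSums.
Context (R : realType) (q : R) (q_ge0 : 0 <= q) (q_lt1 : q < 1).

Lemma sum_growing_le (u : nat -> R) n : (forall k, 0 <= u k) ->
  (forall k, u k <= q * u k.+1) -> \sum_(k < n.+1) u k <= u n / (1 - q).
Proof.
have q1 : 0 < 1 - q by rewrite subr_gt0.
move=> u_ge0 uS; elim: n => [|n IH].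
  by rewrite big_ord1 ler_pdivlMr // ler_piMr // lerBlDr lerDl.
rewrite big_ord_recr /=; apply: (le_trans (lerD IH (lexx _))).
rewrite ler_pdivlMr // mulrDl divfK ?gt_eqF //.
by have := uS n; lra.
Qed.

(** The term at the last index in [P] controls the sum of all terms up to it, whatever the shape of
    [P]. *)
Lemma sum_growing_bound (u : nat -> R) (P : pred nat) (B : R) n :
  (forall k, 0 <= u k) -> (forall k, u k <= q * u k.+1) -> 0 <= B ->
  (forall k, P k -> u k <= B) -> \sum_(k < n | P k) u k <= B / (1 - q).
Proof.
have q1 : 0 < 1 - q by rewrite subr_gt0.
move=> u_ge0 uS B_ge0 uB; elim: n => [|n IH].
  by rewrite big_ord0 divr_ge0 // ltW.
have [Pn|nPn] := boolP (P n); last first.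
  by rewrite big_mkcond big_ord_recr /= (negbTE nPn) addr0 -big_mkcond.
apply: (@le_trans _ _ (\sum_(k < n.+1) u k)).
  by rewrite big_mkcond; apply: ler_sum => k _; case: ifP.
apply: (le_trans (sum_growing_le _ u_ge0 uS)).
by rewrite ler_pM2r ?invr_gt0 // uB.
Qed.

Lemma sum_decaying_le (v : nat -> R) n : (forall k, 0 <= v k) ->
  (forall k, v k.+1 <= q * v k) -> \sum_(k < n) v k <= v 0%N / (1 - q).
Proof.
have q1 : 0 < 1 - q by rewrite subr_gt0.
elim: n v => [|n IH] v v_ge0 vS; first by rewrite big_ord0 divr_ge0 // ltW.
rewrite big_ord_recl /=; have {}IH := IH (fun k => v k.+1) (fun k => v_ge0 _) (fun k => vS _).
apply: (le_trans (lerD (lexx _) IH)).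
rewrite ler_pdivlMr // mulrDl divfK ?gt_eqF //.
by have := vS 0%N; lra.
Qed.

(** Here the first index in [P] controls all later terms, and the induction shifts the sequence. *)
Lemma sum_decaying_bound (v : nat -> R) (P : pred nat) (B : R) n :
  (forall k, 0 <= v k) -> (forall k, v k.+1 <= q * v k) -> 0 <= B ->
  (forall k, P k -> v k <= B) -> \sum_(k < n | P k) v k <= B / (1 - q).
Proof.
have q1 : 0 < 1 - q by rewrite subr_gt0.
move=> + + B_ge0; elim: n v P => [|n IH] v P v_ge0 vS vB.
  by rewrite big_ord0 divr_ge0 // ltW.
have [P0|nP0] := boolP (P 0%N); last first.
  rewrite big_mkcond big_ord_recl /= (negbTE nP0) add0r -big_mkcond.
  exact: (IH (fun k => v k.+1) (fun k => P k.+1) (fun k => v_ge0 _) (fun k => vS _)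
    (fun k => vB _)).
apply: (@le_trans _ _ (\sum_(k < n.+1) v k)).
  by rewrite big_mkcond; apply: ler_sum => k _; case: ifP.
apply: (le_trans (sum_decaying_le _ v_ge0 vS)).
by rewrite ler_pM2r ?invr_gt0 // vB.
Qed.

End GeometricSums.

(* The scales [expR (t k)] have ratio [expR (1 / (1 - eps))] rather than a constant
   ratio, so that the part of the sum over the small scales stays bounded as
   [eps] tends to 1. *)
Lemma multiscale_embedding (R : realType) (X : metricType R) (J : finType)
    (K eps m M : R) :
  0 < K -> 0 < eps -> eps < 1 -> 0 < m ->
  (forall x y : X, x != y -> m <= mdist x y <= M) ->
  (forall tau, 0 < tau -> exists phi : X -> J -> R, forall x y,
    [/\ \sum_j (phi x j - phi y j) ^+ 2 <= K * mdist x y ^+ 2,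
        \sum_j (phi x j - phi y j) ^+ 2 <= K * tau ^+ 2
      & tau <= mdist x y -> tau ^+ 2 <= K * \sum_j (phi x j - phi y j) ^+ 2]) ->
  embeds_ell2_with_distortion (@snowflake R X eps) (2 * K * expR 1 / Num.sqrt eps).
Proof.
move=> K_gt0 eps_gt0 eps_lt1 m_gt0 mM scale.
pose a := 1 - eps.
have a_gt0 : 0 < a by rewrite subr_gt0.
pose t (k : nat) : R := ln m + k%:R / a.
have tS k : t k.+1 = t k + a^-1 by rewrite /t -natr1 mulrDl mul1r addrA.
have atS k : a * t k.+1 = a * t k + 1 by rewrite tS mulrDr divff // gt_eqF.
have /choice[phi phiP] := fun k => scale (expR (t k)) (expR_gt0 _).
(* Enough scales for [t n] to exceed [ln M]. *)
pose n := (Num.truncn (a * (ln M - ln m))).+1.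
pose F (x : X) (j : 'I_n * J) : R := expR (- eps * t j.1) * phi j.1 x j.2.
pose S (k : nat) x y := \sum_j (phi k x j - phi k y j) ^+ 2.
have S_ge0 k x y : 0 <= S k x y by apply: sumr_ge0 => j _; apply: sqr_ge0.
pose w k : R := expR (- eps * t k) ^+ 2.
have w_ge0 k : 0 <= w k by apply: sqr_ge0.
have FE x y : \sum_j (F x j - F y j) ^+ 2 = \sum_(k < n) w k * S k x y.
  rewrite -(pair_bigA _ (fun k j => (F x (k, j) - F y (k, j)) ^+ 2)) /=.
  apply: eq_bigr => k _; rewrite mulr_sumr; apply: eq_bigr => j _.
  by rewrite /F /= -mulrBr exprMn.
pose s := (Num.sqrt K * expR 1)^-1.
have sqrtK_gt0 : 0 < Num.sqrt K by rewrite sqrtr_gt0.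
exists (fun x => ell2_vector (F x)), s; first by rewrite invr_gt0 mulr_gt0 ?expR_gt0.
move=> x y; rewrite ell2_normB FE /snowflake -/a.
have [->|xy] := eqVneq x y.
  rewrite mdistxx powR0 ?gt_eqF // !mulr0 big1 ?sqrtr0 ?lexx // => k _.
  by rewrite /S big1 ?mulr0 // => j _; rewrite subrr expr0n.
have d_gt0 : 0 < mdist x y by rewrite mdist_gt0.
have /andP[m_le d_le] := mM x y xy.
pose d := ln (mdist x y).
have dE : mdist x y = expR d by rewrite /d lnK.
have -> : mdist x y `^ a = expR (a * d) by rewrite /powR gt_eqF.
have sqrB : expR (a * d) ^+ 2 = expR (2 * a * d).
  by rewrite -expRM_natl mulrA.
(* Up to [K], a term is bounded by [u k] through the uniform bound at its scale, and by [v k]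
   through the Lipschitz bound. *)
pose u k := expR (2 * a * t k).
pose v k := expR (2 * d - 2 * eps * t k).
have wu k : w k * expR (t k) ^+ 2 = u k.
  by rewrite /w !expr2 -!expRD /u; congr expR; rewrite /a; lra.
have wv k : w k * mdist x y ^+ 2 = v k.
  by rewrite /w dE !expr2 -!expRD /v; congr expR; lra.
apply/andP; split.
- have d_tn : d < t n.
    have : a * (ln M - ln m) < n%:R by rewrite truncnS_gt.
    rewrite mulrC -ltr_pdivlMr // -/(t n) /t.
    have : d <= ln M by rewrite ler_ln // posrE // (lt_le_trans d_gt0).
    lra.
  have t0_d : t 0%N <= d.
    by rewrite /t mul0r addr0 ler_ln // posrE.
  (* The largest scale [t k] not exceeding [d] alone gives the lower bound; as [a * t] grows by 1
     per scale, this loses a factor [expR 1]. *)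
  have ex : exists k, d < t k by exists n.
  case: (ex_minnP ex) => -[|k] d_lt min_k; first by move: d_lt; rewrite ltNge t0_d.
  have t_le : t k <= d by rewrite leNgt; apply/negP => /min_k; rewrite ltnn.
  have k_n : (k < n)%N by apply: min_k.
  have low : u k <= K * \sum_(k < n) w k * S k x y.
    have [_ _ /(_ _)] := phiP k x y; rewrite dE ler_expR => /(_ t_le) le_S.
    rewrite -wu; apply: (le_trans (ler_wpM2l (w_ge0 k) le_S)).
    rewrite mulrCA ler_pM2l // (bigD1 (Ordinal k_n)) //= lerDl.
    by apply: sumr_ge0 => k' _; apply: mulr_ge0.
  have : expR (a * d) ^+ 2 <= (Num.sqrt K * expR 1 * Num.sqrt (\sum_(k < n) w k * S k x y)) ^+ 2.
    rewrite !exprMn !sqr_sqrtr ?(ltW K_gt0) //; last first.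
      by apply: sumr_ge0 => k' _; apply: mulr_ge0.
    apply: (@le_trans _ _ (u k * expR 1 ^+ 2)).
      rewrite sqrB expr2 -!expRD ler_expR.
      have := atS k; have : a * d <= a * t k.+1 by rewrite ler_pM2l // ltW.
      lra.
    by rewrite mulrAC ler_pM2r ?exprn_gt0 ?expR_gt0.
  rewrite ler_sqr ?nnegrE ?expR_ge0 ?mulr_ge0 ?sqrtr_ge0 ?expR_ge0 //.
  by move=> le_d; rewrite /s mulrC ler_pdivrMr ?mulr_gt0 ?expR_gt0 // [leRHS]mulrC.
- have B_ge0 := expR_ge0 (2 * a * d).
  pose P k := t k <= d.
  (* The ratio [3^-1] comes from [expR 2 >= 1 + 2]. *)
  have sum_u : \sum_(k < n | P k) u k <= expR (2 * a * d) / (1 - 3^-1).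
    apply: (@sum_growing_bound _ 3^-1) => //; first by lra.
    + by move=> k; apply: expR_ge0.
    + move=> k; have -> : u k.+1 = u k * expR 2.
        by rewrite /u -expRD; congr expR; have := atS k; lra.
      have : u k * 3 <= u k * expR 2.
        by rewrite ler_wpM2l ?expR_ge0 //; have := expR_ge1Dx (2 : R); lra.
      lra.
    + by move=> k Pk; rewrite ler_expR ler_pM2l ?mulr_gt0.
  (* [q] is the decay ratio of [v]. Since [expR (2 * eps / a) >= 1 + eps], the factor [1 / (1 - q)]
     is at most [2 / eps], the source of the loss in [eps]. *)
  pose q := expR (- (2 * eps / a)).
  have q_gt0 : 0 < q by apply: expR_gt0.
  have q_le : q * (1 + eps) <= 1.
    rewrite /q expRN mulrC ler_pdivrMr ?expR_gt0 // mul1r.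
    apply: le_trans (expR_ge1Dx _).
    rewrite lerD2l ler_pdivlMr // /a; nra.
  have q_lt1 : q < 1 by nra.
  have sum_v : \sum_(k < n | ~~ P k) v k <= expR (2 * a * d) / (1 - q).
    apply: (@sum_decaying_bound _ q q_lt1 v (predC P)) => //.
    + by move=> k; apply: expR_ge0.
    + move=> k; rewrite /v /q -expRD ler_expR tS mulrDr.
      by rewrite -!mulrA; lra.
    + move=> k; rewrite /= /P -ltNge => lt_t; rewrite ler_expR /a.
      have : eps * d <= eps * t k by rewrite ler_pM2l // ltW.
      lra.
  have up : \sum_(k < n) w k * S k x y <= K * (4 / eps * expR (2 * a * d)).
    have : \sum_(k < n) w k * S k x y <=
        K * (\sum_(k < n | P k) u k + \sum_(k < n | ~~ P k) v k).
      rewrite (bigID (fun k : 'I_n => P k)) /= mulrDr !mulr_sumr.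
      apply: lerD; apply: ler_sum => k _.
        by have [_ le_S _] := phiP k x y; rewrite -wu mulrCA ler_wpM2l.
      by have [le_S _ _] := phiP k x y; rewrite -wv mulrCA ler_wpM2l.
    move/le_trans; apply; rewrite ler_pM2l //.
    apply: (le_trans (lerD sum_u sum_v)).
    rewrite -mulrDr mulrC ler_wpM2r //.
    have q2 : (1 - q)^-1 <= 2 / eps.
      by rewrite -[leLHS]div1r ler_pdivrMr ?subr_gt0 // mulrAC ler_pdivlMr //; nra.
    have e2 : 2 <= 2 / eps by rewrite ler_pdivlMr //; lra.
    have -> : (1 - 3^-1)^-1 = 3 / 2 :> R.
      by apply: (mulfI (_ : 1 - 3^-1 != 0 :> R)); [apply: lt0r_neq0|rewrite divff ?lt0r_neq0]; lra.
    have -> : 4 / eps = 2 / eps + 2 / eps by rewrite -mulrDl; congr (_ / _); lra.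
    lra.
  rewrite -[leRHS]ger0_norm -?sqrtr_sqr; last first.
    by rewrite !mulr_ge0 ?invr_ge0 ?sqrtr_ge0 ?expR_ge0 ?mulr_ge0 ?sqrtr_ge0 ?expR_ge0 // ltW.
  rewrite ler_sqrt ?sqr_ge0 //; apply: (le_trans up).
  have e1 : expR 1 != 0 :> R by rewrite gt_eqF ?expR_gt0.
  (* Squaring turns this constant into [4 * K / eps], as in [up]. *)
  have -> : 2 * K * expR 1 / Num.sqrt eps * s * expR (a * d) =
      2 * (K / Num.sqrt K) * (Num.sqrt eps)^-1 * expR (a * d).
    rewrite /s invfM; field.
    by rewrite !gt_eqF ?sqrtr_gt0 ?expR_gt0.
  rewrite !exprMn sqrB !exprVn !sqr_sqrtr ?(ltW K_gt0) ?(ltW eps_gt0) //.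
  have -> : K ^+ 2 / K = K by rewrite expr2 mulfK // gt_eqF.
  lra.
Qed.

Theorem theorem5p1 (R : realType) (r : nat) :
  exists C : R, forall eps : R, 0 < eps -> eps < 1 ->
    forall X : metricType R, Kr_excluded r X ->
      embeds_ell2_with_distortion (@snowflake R X eps) (C / Num.sqrt eps).
Proof.
pose K : R := (2 ^ r.+1)%:R + 16 * ((7 * r%:R + 10) * r%:R + 1) ^+ 2.
have K_gt0 : 0 < K by rewrite ltr_wpDr ?mulr_ge0 ?sqr_ge0 // ltr0n expn_gt0.
exists (2 * K * expR 1) => eps eps_gt0 eps_lt1 X [G [no_minor [i i_dist]]].
(* Finitely many vertices give finitely many distances; the default 1 keeps [m] positive when no
   distance is. *)
pose m := \big[Num.min/1]_(p : vertex G * vertex G | 0 < gdist p.1 p.2) gdist p.1 p.2.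
pose M := \big[Num.max/0]_(p : vertex G * vertex G) gdist p.1 p.2.
apply: (@multiscale_embedding R X _ K eps m M) => //.
- by apply: lt_bigmin => //; apply: ltr01.
- move=> x y xy; rewrite -(gdist_mdist i_dist); apply/andP; split.
    by apply: (@bigmin_le_cond _ _ _ _ (i x, i y)); rewrite /= (gdist_mdist i_dist) mdist_gt0.
  exact: (@le_bigmax _ _ _ _ (fun p => gdist p.1 p.2) (i x, i y)).
- by move=> tau tau_gt0; apply: single_scale.
Qed.
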